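(* Let $U,\mu,\sigma,\mathcal{L}_\sigma$ be as in the context. Let $m>0$ and $M_D,M_H,M_{U,\sigma},K\ge 0$ be constants such that: (A0) $m\|g-\mu(g)\|_{L^2(\mu)}^2\le\int_{\mathbb{R}^d}\sigma^2|\nabla g|^2\,d\mu$ for all $g\in C_b^1(\mathbb{R}^d)$; (A1) $|\nabla\sigma|\le M_D$, $\sigma|\nabla^2\sigma|_F\le M_H$, $\sigma|\nabla U|\le M_{U,\sigma}$ on $\mathbb{R}^d$, and $\sup_{x}\sigma^2(x)|\nabla^2U(x)|_F<\infty$; (A2) $\sigma^2(x)\nabla^2U(x)\succeq -K I_d$ for all $x\in\mathbb{R}^d$. Set $K_1:=3M_{U,\sigma}M_D+(2+\sqrt d)M_H+(2+2(\sqrt d+2)^2)M_D^2+K$. Then for all $g\in C_c^3(\mathbb{R}^d)$, $$2\Bigl(1+\frac{K_1}{m}\Bigr)\|\mathcal{L}_\sigma g\|_{L^2(\mu)}^2\ \ge\ \int_{\mathbb{R}^d}\sigma^4|\nabla^2g|_F^2\,d\mu .$$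
   Context: Let $d\ge1$ and let $U:\mathbb{R}^d\to\mathbb{R}$ be smooth with $Z_U:=\int e^{-U(x)}dx\in(0,\infty)$; $\mu(dx):=Z_U^{-1}e^{-U(x)}dx$; $\mu(g):=\int g\,d\mu$. Let $\sigma:\mathbb{R}^d\to[1,\infty)$ be smooth and Lipschitz. For $g\in C^2(\mathbb{R}^d)$, $\mathcal{L}_\sigma g:=\mathrm{div}(\sigma^2\nabla g)-\sigma^2\langle\nabla U,\nabla g\rangle$. $|A|_F:=\sqrt{\mathrm{Trace}(A^TA)}$; $A\succeq B$ means $A-B$ is positive semidefinite; $\nabla^2$ is the Hessian. $C_b^1$: bounded $C^1$ functions with bounded derivatives; $C_c^3$: compactly supported $C^3$ functions. *)

(* Defs.v *)
From HB Require Import structures.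
From mathcomp Require Import all_boot all_order all_algebra.
From mathcomp Require Import all_classical all_reals all_analysis.
From mathcomp Require Import measurable_realfun.

Set Implicit Arguments.
Unset Strict Implicit.
Unset Printing Implicit Defensive.
Import Order.TTheory GRing.Theory Num.Theory.
Import numFieldNormedType.Exports.

Local Open Scope classical_set_scope.
Local Open Scope ring_scope.

Section borel_rV.
Context (R : realType) (n : nat).

Definition borel_rV : set (set 'rV[R]_n) := <<s [set A | open A] >>.

Let borel_rV0 : borel_rV set0. Proof. exact: sigma_algebra0. Qed.
Let borel_rVC A : borel_rV A -> borel_rV (~` A).
Proof. exact: sigma_algebraC. Qed.
Let borel_rV_bigcup (F : _^nat) : (forall i, borel_rV (F i)) ->
  borel_rV (\bigcup_i F i).
Proof. exact: sigma_algebra_bigcup. Qed.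

HB.instance Definition _ := @isMeasurable.Build default_measure_display
  'rV[R]_n borel_rV borel_rV0 borel_rVC borel_rV_bigcup.

End borel_rV.

Section measurable_rV.
Context (R : realType).

Lemma open_measurable_rV n (A : set 'rV[R]_n) : open A -> measurable A.
Proof. exact: sub_sigma_algebra. Qed.

Lemma continuous_measurable_rV n (f : 'rV[R]_n -> R) :
  continuous f -> measurable_fun setT f.
Proof.
move=> /continuousP cf; apply: (measurability _ (RGenOpens.measurableE R)) => //.
move=> _ [_ [a [b ->] <-]]; rewrite setTI.
apply: open_measurable_rV; apply: cf; exact: interval_open.
Qed.

Lemma measurable_coord n (i : 'I_n) :
  measurable_fun setT (fun v : 'rV[R]_n => v ord0 i).
Proof. by apply: continuous_measurable_rV; exact: coord_continuous. Qed.

(* Every open subset of [R^n] is a countable union of open boxes with rational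
   centres, so measurability of a vector-valued map is coordinatewise. *)
Lemma measurable_fun_rV d (T : measurableType d) n (f : T -> 'rV[R]_n) :
  (forall i, measurable_fun setT (fun t => f t ord0 i)) ->
  measurable_fun setT f.
Proof.
move=> mf.
apply: (@measurability _ _ _ _ _ _ [set A : set 'rV[R]_n | open A]) => //.
move=> _ [A /= oA <-]; rewrite setTI.
pose c (q : 'rV[rat]_n) : 'rV[R]_n := map_mx ratr q.
pose B (qk : 'rV[rat]_n * nat) := ball (c qk.1) (qk.2.+1%:R^-1).
pose D := [set qk | B qk `<=` A].
have -> : A = \bigcup_(qk in D) B qk.
  apply/seteqP; split=> [x Ax|x [qk Dqk]]; last exact: Dqk.
  have /nbhs_ballP[e /= e0 eA] : nbhs x A by exact: open_nbhs_nbhs.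
  have [k ke] : exists k, k.+1%:R^-1 < e / 2.
    exists (Num.truncn (e / 2)^-1).
    rewrite invf_plt ?posrE ?divr_gt0//.
    exact: truncnS_gt.
  have k0 : 0 < (k.+1%:R^-1 : R) by rewrite invr_gt0.
  have hq (i : 'I_n) : exists q : rat, ball (x ord0 i) (k.+1%:R^-1) (ratr q).
    have xk : ball (x ord0 i) (k.+1%:R^-1 : R) !=set0.
      by exists (x ord0 i); exact: ballxx.
    have [y [xy [q _ qy]]] :
        ball (x ord0 i) (k.+1%:R^-1 : R) `&` range ratr !=set0.
      by apply: dense_rat => //; exact: ball_open.
    by exists q; rewrite qy.
  have /choice[q qP] := hq.
  have bq : ball (c (\row_i q i)) (k.+1%:R^-1) x.
    by split=> // i j; rewrite ord1 !mxE; exact/ball_sym/qP.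
  exists (\row_i q i, k) => //= y ybq; apply: eA.
  rewrite (splitr e); apply: (@ball_triangle _ _ (c (\row_i q i))).
    exact/ball_sym/(le_ball (ltW ke)).
  exact: (le_ball (ltW ke)).
rewrite preimage_bigcup bigcup_mkcond.
apply: countable_bigcupT_measurable => [|[q k]]; first exact: countableP.
case: ifPn => // _.
rewrite (_ : _ @^-1` _ = \bigcap_(i in [set: 'I_n])
    ((fun t => f t ord0 i) @^-1` ball (c q ord0 i) (k.+1%:R^-1 : R))).
  apply: fin_bigcap_measurable; first exact: finite_finset.
  by move=> i _; rewrite -[X in measurable X]setTI; apply: mf => //;
    apply: open_measurable; exact: ball_open.
apply/seteqP; split=> t /=.
  by move=> [_ bt] i _; exact: bt.
by move=> bt; split=> [|i j]; [rewrite invr_gt0|rewrite ord1; exact: bt].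
Qed.

End measurable_rV.

(* Lebesgue measure on [R^n], by the recursion that defines the product measure
   [lebesgue_measure \x lebesgue_rV n] through its sections. *)
Fixpoint lebesgue_rV (R : realType) (n : nat) : set 'rV[R]_n -> \bar R :=
  match n with
  | 0 => fun A => \d_(0 : 'rV[R]_0) A
  | p.+1 => fun A : set 'rV[R]_(1 + p) =>
      (\int[lebesgue_measure]_x
         lebesgue_rV [set y : 'rV[R]_p | A (row_mx x%:M y)])%E
  end.

Section lebesgue_rV_measure.
Context (R : realType).

Let cons_rV n (xy : R * 'rV[R]_n) : 'rV[R]_(1 + n) := row_mx xy.1%:M xy.2.

Let cons_rVl n (xy : R * 'rV[R]_n) (j : 'I_1) :
  cons_rV xy ord0 (lshift n j) = xy.1.
Proof. by rewrite /cons_rV row_mxEl mxE !ord1 eqxx mulr1n. Qed.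

Let cons_rVr n (xy : R * 'rV[R]_n) (j : 'I_n) :
  cons_rV xy ord0 (rshift 1 j) = xy.2 ord0 j.
Proof. by rewrite /cons_rV row_mxEr. Qed.

Let measurable_cons_rV n : measurable_fun setT (@cons_rV n).
Proof.
apply: measurable_fun_rV => i; case: (split_ordP i) => j ->.
  rewrite (_ : (fun t => _) = fst) ?measurable_fst//.
  by apply/funext => t; rewrite cons_rVl.
rewrite (_ : (fun t => _) = (fun v : 'rV[R]_n => v ord0 j) \o snd).
  by apply: measurableT_comp; [exact: measurable_coord|exact: measurable_snd].
by apply/funext => t; rewrite cons_rVr.
Qed.

Let uncons_rV n (v : 'rV[R]_(1 + n)) : R * 'rV[R]_n :=
  (v ord0 (lshift n ord0), \row_j v ord0 (rshift 1 j)).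

Let measurable_uncons_rV n : measurable_fun setT (@uncons_rV n).
Proof.
apply: measurable_fun_pair; first exact: measurable_coord.
apply: measurable_fun_rV => i; rewrite (_ : (fun t => _) =
  (fun v : 'rV[R]_(1 + n) => v ord0 (rshift 1 i))); first exact: measurable_coord.
by apply/funext => t; rewrite mxE.
Qed.

Let cons_rVK n : cancel (@cons_rV n) (@uncons_rV n).
Proof.
move=> [x y]; rewrite /uncons_rV cons_rVl; congr pair.
by apply/rowP => j; rewrite mxE cons_rVr.
Qed.

Lemma lebesgue_rV_ge0 n (A : set 'rV[R]_n) : (0 <= lebesgue_rV A)%E.
Proof.
by elim: n A => [|n IH] A; [exact: measure_ge0|exact: integral_ge0].
Qed.

Section step.
Variables (n : nat) (m : {sigma_finite_measure set 'rV[R]_n -> \bar R}).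

Let step := pushforward (lebesgue_measure \x m)%E (@cons_rV n).

Let step0 : step set0 = 0%E.
Proof. by rewrite /step /pushforward preimage_set0 measure0. Qed.

Let step_ge0 A : (0 <= step A)%E.
Proof. by apply: integral_ge0 => x _; exact: measure_ge0. Qed.

Let step_sigma_additive : semi_sigma_additive step.
Proof.
exact: (@measure_semi_sigma_additive _ _ _
  (measure_function_pushforward__canonical__measure_function_Measure
    (lebesgue_measure \x m)%E (@measurable_cons_rV n))).
Qed.

HB.instance Definition _ := isMeasure.Build _ _ _ step
  step0 step_ge0 step_sigma_additive.

Let step_sigma_finite : sigma_finite setT step.
Proof.
have /sigma_finiteP[F [TF ndF Foo]] := sigma_finiteT (@lebesgue_measure R).
have /sigma_finiteP[G [TG ndG Goo]] := sigma_finiteT m.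
exists (fun k => @uncons_rV n @^-1` (F k `*` G k)).
  apply/seteqP; split=> // v _.
  have [i _ Fi] : (\bigcup_i F i) (uncons_rV v).1 by rewrite -TF.
  have [j _ Gj] : (\bigcup_i G i) (uncons_rV v).2 by rewrite -TG.
  exists (maxn i j) => //; split.
    by move: Fi; exact/subsetPset/ndF/leq_maxl.
  by move: Gj; exact/subsetPset/ndG/leq_maxr.
move=> k; have [mF Fk] := Foo k; have [mG Gk] := Goo k; split.
  rewrite -[X in measurable X]setTI; apply: measurable_uncons_rV => //.
  exact: measurableX.
rewrite /= /step /pushforward -comp_preimage.
rewrite (_ : _ \o _ = id) ?preimage_id; last first.
  by apply/funext => xy; exact: cons_rVK.
by rewrite product_measure1E// lte_mul_pinfty// ge0_fin_numE.
Qed.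

HB.instance Definition _ := Measure_isSigmaFinite.Build _ _ _ step
  step_sigma_finite.

Local Lemma lebesgue_rV_step :
  (forall A, measurable A -> lebesgue_rV A = m A) ->
  exists m' : {sigma_finite_measure set 'rV[R]_n.+1 -> \bar R},
  forall A, measurable A -> lebesgue_rV A = m' A.
Proof.
move=> mE; exists step => A mA.
rewrite /= /step /pushforward /product_measure1.
apply: eq_integral => x _ /=; rewrite mE.
  by congr (m _); apply/seteqP; split=> y /=; rewrite /xsection/= inE.
rewrite (_ : [set y | _] = (fun y => cons_rV (x, y)) @^-1` A)//.
rewrite -[X in measurable X]setTI.
by apply: (measurable_fun_pair2 x (@measurable_cons_rV n)).
Qed.

End step.

Let lebesgue_rV_ex n : exists m : {sigma_finite_measure set 'rV[R]_n -> \bar R},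
  forall A, measurable A -> lebesgue_rV A = m A.
Proof.
elim: n => [|n [m mE]]; last exact: lebesgue_rV_step mE.
by exists \d_(0 : 'rV[R]_0).
Qed.

Variable n : nat.

Let lebesgue_rV0 : @lebesgue_rV R n set0 = 0%E.
Proof. by have [m mE] := lebesgue_rV_ex n; rewrite mE ?measure0. Qed.

Let lebesgue_rV_sigma_additive : semi_sigma_additive (@lebesgue_rV R n).
Proof.
have [m mE] := lebesgue_rV_ex n => F mF tF mUF; rewrite mE//.
rewrite (_ : (fun k => _) = (fun k => \sum_(0 <= i < k) m (F i))%E).
  exact: measure_semi_sigma_additive.
by apply/funext => k; apply: eq_bigr => i _; exact: mE.
Qed.

HB.instance Definition _ := isMeasure.Build _ _ _ (@lebesgue_rV R n)
  lebesgue_rV0 (@lebesgue_rV_ge0 n) lebesgue_rV_sigma_additive.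

Let lebesgue_rV_sigma_finite : sigma_finite setT (@lebesgue_rV R n).
Proof.
have [m mE] := lebesgue_rV_ex n; have [F TF Foo] := sigma_finiteT m.
by exists F => // k; have [? ?] := Foo k; rewrite mE.
Qed.

HB.instance Definition _ := Measure_isSigmaFinite.Build _ _ _
  (@lebesgue_rV R n) lebesgue_rV_sigma_finite.

End lebesgue_rV_measure.

Section calculus.
Context (R : realType) (d : nat).
Implicit Types (f : 'rV[R]_d -> R) (F : 'rV[R]_d -> 'rV[R]_d) (x u v : 'rV[R]_d).

Definition dotv u v : R := \sum_(i < d) u ord0 i * v ord0 i.

(* The norm [`|v|] of the library is the sup norm. *)
Definition enorm v : R := Num.sqrt (dotv v v).

Definition frobenius (A : 'M[R]_d) : R := Num.sqrt (\tr (A^T *m A)).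

(* Symmetry is not part of the definition: it is only applied to combinations of
   the identity and of Hessians of smooth functions, which are symmetric. *)
Definition psd (A : 'M[R]_d) : Prop :=
  forall v, 0 <= (v *m A *m v^T) ord0 ord0.

Definition partial (i : 'I_d) f : 'rV[R]_d -> R := 'D_(delta_mx ord0 i) f.

Definition grad f x : 'rV[R]_d := \row_i partial i f x.

Definition hess f x : 'M[R]_d := \matrix_(i, j) partial j (partial i f) x.

Definition divergence F x : R := \sum_(i < d) partial i (fun y => F y ord0 i) x.

Fixpoint Ck (k : nat) f : Prop :=
  match k with
  | 0 => continuous f
  | l.+1 => (forall x, differentiable f x) /\ forall i, Ck l (partial i f)
  end.

Definition smooth f : Prop := forall k, Ck k f.

Definition Cb1 f : Prop :=
  [/\ Ck 1 f, exists M, forall x, `|f x| <= M &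
      exists M, forall x, enorm (grad f x) <= M].

Definition Cc3 f : Prop := Ck 3 f /\ compact (closure [set x | f x != 0]).

Definition lipschitz_enorm f : Prop :=
  exists L, forall x y, `|f x - f y| <= L * enorm (x - y).

Definition generator U (s g : 'rV[R]_d -> R) x : R :=
  divergence (fun y => s y ^+ 2 *: grad g y) x
  - s x ^+ 2 * dotv (grad U x) (grad g x).

End calculus.

Section gibbs.
Context (R : realType) (d : nat).
Implicit Types (U g : 'rV[R]_d -> R).

Definition partition_function U : \bar R :=
  (\int[@lebesgue_rV R d]_x (expR (- U x))%:E)%E.

(* The measure [Z_U^-1 e^(-U) dx] when [0 < Z_U < +oo]. It is kept as a bare set
   function, which is all that the integral requires, since countable additivity
   needs [U] measurable; for such [U] it has a [measure] instance below. *)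
Definition gibbs U (A : set 'rV[R]_d) : \bar R :=
  (\int[@lebesgue_rV R d]_(x in A)
     ((fine (partition_function U))^-1 * expR (- U x))%:E)%E.

Definition gibbs_mean U g : R := fine (\int[gibbs U]_x (g x)%:E)%E.

Definition gibbs_sqnorm2 U g : \bar R := (\int[gibbs U]_x (`|g x| ^+ 2)%:E)%E.

End gibbs.

Section gibbs_measure.
Context (R : realType) (d : nat) (U : 'rV[R]_d -> R).
Hypothesis mU : measurable_fun setT U.

Let density (x : 'rV[R]_d) : \bar R :=
  ((fine (partition_function U))^-1 * expR (- U x))%:E.

Let density_ge0 x : (0 <= density x)%E.
Proof.
rewrite lee_fin mulr_ge0 ?expR_ge0// invr_ge0 fine_ge0//.
by apply: integral_ge0 => y _; rewrite lee_fin expR_ge0.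
Qed.

Let gibbs0 : gibbs U set0 = 0%E.
Proof. by rewrite /gibbs integral_set0. Qed.

Let gibbs_ge0 A : (0 <= gibbs U A)%E.
Proof. by apply: integral_ge0 => x _; exact: density_ge0. Qed.

Let gibbs_sigma_additive : semi_sigma_additive (gibbs U).
Proof.
move=> F mF tF mUF; rewrite /gibbs ge0_integral_bigcup//; last first.
- by move=> x _; exact: density_ge0.
- apply/measurable_EFinP/measurable_funM => //.
  apply: measurableT_comp => //; apply: measurableT_comp => //.
  exact: measurable_funS mU.
apply: is_cvg_ereal_nneg_natsum => k _.
by apply: integral_ge0 => x _; exact: density_ge0.
Qed.

HB.instance Definition _ := isMeasure.Build _ _ _ (gibbs U)
  gibbs0 gibbs_ge0 gibbs_sigma_additive.

End gibbs_measure.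

(* Main.v *)
(** With F := s^2 grad g and the weighted divergence
    L = sum_i (d_i F_i - F_i d_i U) = e^U div (e^(-U) F), the generator
    applied to g is L.  Weighted divergences of compactly supported fields have
    mu-integral zero; applied to the weighted divergence of
    G_i := F_i L - sum_j F_j d_j F_i this gives

      int L^2 dmu = int tr((DF)^2) + <F, U'' F> dmu.

    As d_j F_i = s^2 d_ij g + 2 s d_j s d_i g, Young's inequality bounds
    tr((DF)^2) below by s^4 |g''|^2 / 2 - 4 MD^2 s^2 |grad g|^2, and the lower
    bound on s^2 U'' costs K s^2 |grad g|^2.  Finally, integrating the weighted
    divergence of g F shows that
    int s^2 |grad g|^2 dmu = - int (g - c) L dmu for every constant c, so the
    Poincare inequality and Young's inequality give
    m int s^2 |grad g|^2 dmu <= int L^2 dmu. *)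

Require Import Defs.
From HB Require Import structures.
From mathcomp Require Import all_boot all_order all_algebra.
From mathcomp Require Import all_classical all_reals all_analysis.
From mathcomp Require Import measurable_realfun ring lra.

Set Implicit Arguments.
Unset Strict Implicit.
Unset Printing Implicit Defensive.
Import Order.TTheory GRing.Theory Num.Theory.
Import numFieldNormedType.Exports.

Local Open Scope classical_set_scope.
Local Open Scope ring_scope.

(** * Integration on R^n *)

Section lebesgue_rV_fubini.
Context {R : realType}.

(** The target is cast from ['rV_(1 + n)] to ['rV_n.+1], so that coordinates split into [ord0] and
    [lift ord0 j], the form used by inductions on the dimension. *)
Definition cons_rV n (xy : R * 'rV[R]_n) : 'rV[R]_n.+1 :=
  row_mx (xy.1)%:M xy.2 : 'rV_(1 + n).

Lemma cons_rV0 n xy : @cons_rV n xy ord0 ord0 = xy.1.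
Proof.
have -> : (ord0 : 'I_n.+1) = lshift n (ord0 : 'I_1) by exact/val_inj.
by rewrite [LHS](row_mxEl xy.1%:M xy.2) mxE.
Qed.

Lemma cons_rVS n xy (j : 'I_n) : @cons_rV n xy ord0 (lift ord0 j) = xy.2 ord0 j.
Proof.
have -> : lift (ord0 : 'I_n.+1) j = rshift 1 j by exact/val_inj.
exact: (row_mxEr xy.1%:M xy.2).
Qed.

Lemma continuous_cons_rV n : continuous (@cons_rV n).
Proof.
move=> xy A /nbhs_ballP[e /= e0 eA]; apply/nbhs_ballP; exists e => //= -[x y].
move=> [/= bx [_ bny]]; apply: eA; split=> // i j; rewrite ord1.
case: (unliftP ord0 j) => [k|] ->; first by rewrite !cons_rVS; exact: bny.
by rewrite !cons_rV0.
Qed.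

Lemma measurable_cons_rV n : measurable_fun setT (@cons_rV n).
Proof.
apply: measurable_fun_rV => i; case: (unliftP ord0 i) => [j|] ->.
  under [X in measurable_fun _ X]eq_fun do rewrite cons_rVS.
  by apply: measurableT_comp (@measurable_coord R n j) _; exact: measurable_snd.
under [X in measurable_fun _ X]eq_fun do rewrite cons_rV0.
exact: measurable_fst.
Qed.

(** The recursion that defines [lebesgue_rV] is the section formula of the product measure; only the
    description of the sections differs. *)
Lemma lebesgue_rVS n (A : set 'rV[R]_n.+1) : measurable A ->
  lebesgue_rV A =
  pushforward (lebesgue_measure \x @lebesgue_rV R n)%E (@cons_rV n) A.
Proof.
move=> mA; rewrite /= /pushforward /product_measure1.
apply: eq_integral => x _ /=.
by congr lebesgue_rV; apply/seteqP; split=> y /=; rewrite /xsection/= inE.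
Qed.

Lemma integral_lebesgue_rVS n (f : 'rV[R]_n.+1 -> \bar R) :
  (@lebesgue_rV R n.+1).-integrable setT f ->
  (lebesgue_measure \x @lebesgue_rV R n)%E.-integrable setT (f \o @cons_rV n) /\
  (\int[@lebesgue_rV R n.+1]_x f x =
   \int[(lebesgue_measure \x @lebesgue_rV R n)%E]_x f (cons_rV x))%E.
Proof.
move=> fi.
have mf : measurable_fun setT f by exact: measurable_int fi.
have mc : measurable_fun [set: measurableTypeR R * 'rV[R]_n] (@cons_rV n).
  exact: measurable_cons_rV.
(* The pushforward is bundled as a measure; its agreement with [lebesgue_rV] on measurable sets is
   enough for integrals to coincide. *)
pose P : {measure set 'rV[R]_n.+1 -> \bar R} :=
  measure_function_pushforward__canonical__measure_function_Measure
    (lebesgue_measure \x @lebesgue_rV R n)%E mc.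
have PE A : measurable A -> A `<=` setT -> (@lebesgue_rV R n.+1) A = P A.
  by move=> mA _; exact: lebesgue_rVS.
have ci : (lebesgue_measure \x @lebesgue_rV R n)%E.-integrable setT
    (f \o @cons_rV n).
  apply/integrableP; split; first exact: measurableT_comp.
  have /integrableP[_] := fi; apply: le_lt_trans.
  rewrite (eq_measure_integral P)// ge0_integral_pushforward//.
  exact: measurableT_comp.
split=> //; rewrite (eq_measure_integral P)//.
exact: (integral_pushforward mc mf ci measurableT).
Qed.

(** Described coordinatewise, a cube is pulled back by [cons_rV] to an interval times a smaller
    cube, so finiteness of its measure follows by induction. *)
Definition cube n (B : R) : set 'rV[R]_n :=
  [set v | forall i, `|v ord0 i| <= B].

Lemma measurable_cube n B : measurable (@cube n B).
Proof.
rewrite (_ : @cube n B = \bigcap_(i in [set: 'I_n])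
    ((fun v : 'rV[R]_n => v ord0 i) @^-1` `[- B, B])).
  apply: fin_bigcap_measurable; first exact: finite_finset.
  by move=> i _; rewrite -[X in measurable X]setTI; exact: measurable_coord.
apply/seteqP; split=> v /= vB i => [_|].
  by rewrite /= in_itv/= -ler_norml; exact: vB.
by have := vB i Logic.I; rewrite /= in_itv/= -ler_norml.
Qed.

Lemma lebesgue_rV_cube_lty n B : (lebesgue_rV (@cube n B) < +oo)%E.
Proof.
elim: n => [|n IH].
  rewrite (le_lt_trans (probability_le1 _ _)) ?ltry//.
  exact: measurable_cube.
rewrite lebesgue_rVS; last exact: measurable_cube.
rewrite /pushforward (_ : _ @^-1` _ = `[- B, B] `*` @cube n B).
  rewrite product_measure1E//; last exact: measurable_cube.
  have lB : (lebesgue_measure (`[(- B)%R, B]%classic : set R) < +oo)%E.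
    by rewrite lebesgue_measure_itv/=; case: ifPn => // _; rewrite -EFinB ltry.
  apply: lte_mul_pinfty => //; first by rewrite ge0_fin_numE.
apply/seteqP; split=> -[x y] /=.
  move=> xyB; split=> /=.
    by have := xyB ord0; rewrite cons_rV0/= in_itv/= ler_norml.
  by move=> i; have := xyB (lift ord0 i); rewrite cons_rVS.
rewrite in_itv/= -ler_norml => -[xB yB] i.
by case: (unliftP ord0 i) => [k|] ->; rewrite ?cons_rVS ?cons_rV0//; exact: yB.
Qed.

Lemma integrable_lebesgue_rV n (f : 'rV[R]_n -> R) B M :
  continuous f -> (forall x, `|f x| <= M) ->
  (forall x, ~ cube B x -> f x = 0) ->
  (@lebesgue_rV R n).-integrable setT (EFin \o f).
Proof.
move=> cf fM f0; have mf := continuous_measurable_rV cf.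
apply: (@eq_integrable _ _ _ _ _ measurableT ((EFin \o f) \_ (@cube n B))).
  move=> x _; rewrite /= patchE; case: ifPn => //; rewrite notin_setE => /f0.
  by move=> ->.
apply/integrable_restrict => //; first exact: measurable_cube.
rewrite setTI.
apply: measurable_bounded_integrable.
- exact: measurable_cube.
- exact: lebesgue_rV_cube_lty.
- exact: measurable_funTS.
- exists M; split; first exact: num_real.
  by move=> N /ltW MN x _; apply: le_trans MN; exact: fM.
Qed.

End lebesgue_rV_fubini.

(** * Lebesgue integrals of partial derivatives *)

Section integral_partial.
Context {R : realType}.

Lemma cons_rV_shiftS n (x h : R) (y : 'rV[R]_n) (j : 'I_n) :
  cons_rV (x, h *: delta_mx ord0 j + y) =
  h *: delta_mx ord0 (lift ord0 j) + cons_rV (x, y).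
Proof.
apply/rowP => i; case: (unliftP ord0 i) => [k|] ->.
  rewrite cons_rVS [LHS]mxE [RHS]mxE cons_rVS; congr (_ + _).
  by rewrite !mxE (inj_eq lift_inj).
rewrite cons_rV0 [RHS]mxE cons_rV0 !mxE (negbTE (neq_lift _ _)).
by rewrite andbF mulr0 add0r.
Qed.

Lemma cons_rV_shift0 n (t h : R) (y : 'rV[R]_n) :
  cons_rV (h + t, y) = h *: delta_mx ord0 ord0 + cons_rV (t, y).
Proof.
apply/rowP => i; case: (unliftP ord0 i) => [k|] ->.
  rewrite cons_rVS [RHS]mxE cons_rVS !mxE [lift _ _ == _]eq_sym.
  by rewrite (negbTE (neq_lift _ _)) andbF mulr0 add0r.
by rewrite cons_rV0 [RHS]mxE cons_rV0 !mxE !eqxx mulr1.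
Qed.

(** A directional derivative depends only on the restriction to a line, so it transfers between
    functions on different spaces; this serves both for slices and for one-variable restrictions. *)
Lemma is_derive_eq_line (V V' : normedModType R) (f : V -> R) (g : V' -> R)
    (x v : V) (y w : V') :
  (forall h : R, g (h *: w + y) = f (h *: v + x)) -> derivable f x v ->
  is_derive y w g ('D_v f x).
Proof.
move=> gf df; have gf0 : g y = f x.
  by have := gf 0; rewrite !scale0r !add0r.
pose q (h : R) := h^-1 *: (f (h *: v + x) - f x).
have qE : (fun h : R => h^-1 *: (g (h *: w + y) - g y)) = q.
  by apply/funext => h; rewrite gf gf0.
by apply: DeriveDef; rewrite /derivable /derive /= qE.
Qed.

Lemma is_derive_slice n (f : 'rV[R]_n.+1 -> R) x y (j : 'I_n) :
  derivable f (cons_rV (x, y)) (delta_mx ord0 (lift ord0 j)) ->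
  is_derive y (delta_mx ord0 j : 'rV[R]_n) (fun y => f (cons_rV (x, y)))
    (partial (lift ord0 j) f (cons_rV (x, y))).
Proof. by apply: is_derive_eq_line => h; rewrite cons_rV_shiftS. Qed.

Lemma is_derive_line n (f : 'rV[R]_n.+1 -> R) t y :
  derivable f (cons_rV (t, y)) (delta_mx ord0 ord0) ->
  is_derive t 1 (fun t => f (cons_rV (t, y))) (partial ord0 f (cons_rV (t, y))).
Proof.
by apply: is_derive_eq_line => h; rewrite [h%:A]mulr1 cons_rV_shift0.
Qed.

Lemma partial_eq0 n (f : 'rV[R]_n -> R) i x :
  (\forall y \near x, f y = 0) -> partial i f x = 0.
Proof.
by move=> fx; rewrite /partial (near_eq_derive (g := cst 0))// derive_cst.
Qed.

Lemma near_notin_cube n B (x : 'rV[R]_n) :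
  ~ cube B x -> \forall y \near x, ~ cube B y.
Proof.
move=> /existsNP[i /negP]; rewrite -ltNge => Bi.
have : nbhs x [set y : 'rV[R]_n | B < `|y ord0 i|].
  have c : {for x, continuous (fun y : 'rV[R]_n => `|y ord0 i|)}.
    apply: continuous_comp; first exact: coord_continuous.
    exact: norm_continuous.
  exact: (c _ (lt_nbhsr Bi)).
by apply: filterS => y Biy yB; have := yB i; rewrite leNgt Biy.
Qed.

Lemma integral_derive_eq0 (g dg : R -> R) (B : R) :
  (forall t : R, is_derive t 1 g (dg t)) -> continuous dg ->
  (forall t, B < `|t| -> g t = 0) -> (forall t, B < `|t| -> dg t = 0) ->
  (\int[lebesgue_measure]_t (dg t)%:E = 0)%E.
Proof.
(* [B] may be negative; [b] is positive and exceeds [B], so [[-b, b]] is a nondegenerate interval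
   with [g] vanishing at both endpoints. *)
move=> gd cdg g0 dg0; pose b : R := `|B| + 1.
have b0 : 0 < b by rewrite ltr_wpDl.
have Bb : B < b by rewrite ltr_pwDr// ler_norm.
have cg : continuous g.
  by move=> t; apply/differentiable_continuous/derivable1_diffP; case: (gd t).
have -> : (\int[lebesgue_measure]_t (dg t)%:E =
    \int[lebesgue_measure]_(t in `[(- b)%R, b]) (dg t)%:E)%E.
  rewrite [RHS]integral_mkcond; apply: eq_integral => t _.
  rewrite patchE; case: ifPn => //; rewrite notin_setE/= in_itv/= -ler_norml.
  by move=> /negP; rewrite -ltNge => bt; rewrite dg0// (lt_trans Bb).
rewrite (@continuous_FTC2 _ _ g) ?gtrN//.
- by rewrite !g0 ?subee// ?normrN gtr0_norm.
- exact: continuous_subspaceT.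
- split.
  + by move=> t _; case: (gd t).
  + by apply: cvg_at_right_filter; exact: cg.
  + by apply: cvg_at_left_filter; exact: cg.
- by move=> t _; rewrite derive1E; case: (gd t).
Qed.

(* The hypotheses only involve the direction [i], so that they are inherited by
   the slices of [f] on which the induction acts. *)
Lemma integral_partial_eq0 n (i : 'I_n) (f : 'rV[R]_n -> R) B M :
  (forall x, derivable f x (delta_mx ord0 i)) -> continuous (partial i f) ->
  (forall x, `|partial i f x| <= M) -> (forall x, ~ cube B x -> f x = 0) ->
  (\int[@lebesgue_rV R n]_x (partial i f x)%:E = 0)%E.
Proof.
elim: n i f => [|n IH] i f df cf fM f0; first by case: i df cf fM.
have pf0 x : ~ cube B x -> partial i f x = 0.
  by move=> /near_notin_cube Bx; apply: partial_eq0; apply: filterS Bx.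
have [fi ->] := integral_lebesgue_rVS (integrable_lebesgue_rV cf fM pf0).
have notcube0 t y : B < `|t| -> ~ cube B (cons_rV (t, y) : 'rV[R]_n.+1).
  by move=> Bt /(_ ord0); rewrite cons_rV0/= leNgt Bt.
have notcubeS t y : ~ cube B y -> ~ cube B (cons_rV (t, y) : 'rV[R]_n.+1).
  by move=> By yB; apply: By => j; have := yB (lift ord0 j); rewrite cons_rVS.
have consl y : continuous (fun t => cons_rV (t, y) : 'rV[R]_n.+1).
  move=> t; apply: (@continuous_comp _ _ _ (fun t => (t, y)) (@cons_rV R n)).
    move=> A [[P Q] /= [Pt Qy] PQA]; apply: filterS Pt => z Pz.
    by apply: PQA; split=> //=; exact: nbhs_singleton.
  exact: continuous_cons_rV.
have consr t : continuous (fun y => cons_rV (t, y) : 'rV[R]_n.+1).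
  move=> y; apply: (@continuous_comp _ _ _ (fun y => (t, y)) (@cons_rV R n)).
    move=> A [[P Q] /= [Pt Qy] PQA]; apply: filterS Qy => z Qz.
    by apply: PQA; split=> //=; exact: nbhs_singleton.
  exact: continuous_cons_rV.
case: (unliftP ord0 i) df cf fM pf0 fi => [j|] -> df cf fM pf0 fi.
  (* The direction lies among the last coordinates: these are integrated first, and the inner
     integral vanishes by induction on the slice. *)
  rewrite -integral12_prod_meas1//.
  apply: integral0_eq => t _; rewrite /fubini_F/=.
  have sl y := is_derive_slice (df (cons_rV (t, y))).
  have slE : partial j (fun y => f (cons_rV (t, y))) =
      partial (lift ord0 j) f \o (fun y => cons_rV (t, y)).
    by apply/funext => y; have [_] := sl y.
  have := IH j (fun y => f (cons_rV (t, y))); rewrite slE; apply.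
  - by move=> y; have [] := sl y.
  - by move=> y; apply: continuous_comp; [exact: consr|exact: cf].
  - by move=> y; exact: fM.
  - by move=> y By; exact/f0/notcubeS.
(* The direction is the first coordinate: it is integrated first, by the one-variable case. *)
rewrite -integral21_prod_meas1//.
apply: integral0_eq => y _; rewrite /fubini_G/=.
apply: (@integral_derive_eq0 (fun t => f (cons_rV (t, y))) _ B).
- by move=> t; exact/is_derive_line/df.
- by move=> t; apply: continuous_comp; [exact: consl|exact: cf].
- by move=> t Bt; exact/f0/notcube0.
- by move=> t Bt; exact/pf0/notcube0.
Qed.

End integral_partial.

(** * Density of the Gibbs measure *)

Section density.
Local Open Scope ereal_scope.
Context d (T : measurableType d) (R : realType).
Variables (mu nu : {measure set T -> \bar R}) (h : T -> R).
Hypotheses (mh : measurable_fun setT h) (h0 : forall x, (0 <= h x)%R)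
  (nuE : forall A, measurable A -> nu A = \int[mu]_(x in A) (h x)%:E).

Import HBNNSimple.

(** On indicators this is [nuE]; linearity extends it to simple functions, and monotone convergence
    on both sides to nonnegative measurable functions. *)
Lemma ge0_integral_density (f : T -> \bar R) :
  measurable_fun setT f -> (forall x, 0 <= f x) ->
  \int[nu]_x f x = \int[mu]_x (f x * (h x)%:E).
Proof.
move=> mf f0; pose f_ := nnsfun_approx measurableT mf.
have mhE : measurable_fun setT (EFin \o h) by exact/measurable_EFinP.
have h0E x : 0 <= (h x)%:E by rewrite lee_fin.
have f_cvg x : EFin \o f_^~ x @ \oo --> f x by exact: cvg_nnsfun_approx.
have f_nd x : {homo (fun n => (f_ n x)%:E) : m n / (m <= n)%N >-> m <= n}.
  by move=> m n mn; rewrite lee_fin; exact/lefP/nd_nnsfun_approx.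
transitivity (limn (fun n => \int[nu]_x (f_ n x)%:E)).
  rewrite -monotone_convergence//.
  - by apply: eq_integral => x _; apply/esym/cvg_lim => //; exact: f_cvg.
  - by move=> n; exact/measurable_EFinP/measurable_funP.
  - by move=> n x _; rewrite lee_fin.
transitivity (limn (fun n => \int[mu]_x ((f_ n x)%:E * (h x)%:E))); last first.
  rewrite -monotone_convergence//.
  - apply: eq_integral => x _; apply: cvg_lim => //.
    by apply: cvgeZr => //; exact: f_cvg.
  - move=> n; apply: emeasurable_funM => //.
    exact/measurable_EFinP/measurable_funP.
  - by move=> n x _; rewrite mule_ge0// lee_fin.
  - by move=> x _ m n mn; rewrite lee_wpmul2r//; exact: f_nd.
congr (limn _); apply/funext => n.
rewrite integralT_nnsfun sintegralE.
have mi r : measurable (f_ n @^-1` [set r]) by exact: measurable_sfunP.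
have ri0 r x : 0 <= (r * \1_(f_ n @^-1` [set r]) x)%:E.
  by rewrite EFinM; exact: nnfun_muleindic_ge0.
transitivity (\sum_(r \in range (f_ n))
    \int[mu]_x ((r * \1_(f_ n @^-1` [set r]) x)%:E * (h x)%:E)); last first.
  rewrite -ge0_integral_fsum//.
  - apply: eq_integral => x _; rewrite -ge0_mule_fsuml//.
    by rewrite [in RHS]fimfunE -fsumEFin.
  - move=> r; apply: emeasurable_funM => //; apply/measurable_EFinP.
    exact: measurable_funM.
  - by move=> r x _; rewrite mule_ge0.
apply: eq_fsbigr => r /[!inE] -[t _ ftr].
have r0 : 0 <= r%:E by rewrite lee_fin -ftr.
under [RHS]eq_integral do rewrite EFinM -muleA.
rewrite ge0_integralZl//.
- rewrite nuE// [in LHS]integral_mkcond; congr (_ * _).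
  by apply: eq_integral => x _; rewrite epatch_indic muleC.
- apply: emeasurable_funM => //; apply/measurable_EFinP.
  exact: measurable_indic.
- by move=> x _; rewrite mule_ge0// lee_fin.
Qed.


(** Multiplication by [h >= 0] commutes with taking positive and negative parts, which reduces to
    the nonnegative case. *)
Lemma integral_density (f : T -> R) :
  nu.-integrable setT (EFin \o f) ->
  \int[nu]_x (f x)%:E = \int[mu]_x (f x * h x)%:E.
Proof.
move=> fi.
have mf : measurable_fun setT (EFin \o f) by exact: measurable_int fi.
rewrite [LHS]integralE [RHS]integralE.
rewrite !ge0_integral_density//;
  [|exact: measurable_funeneg|exact: measurable_funepos].
congr (_ - _); apply: eq_integral => x _.
- by rewrite !funeposE -EFin_max -EFinM -EFin_max maxr_pMl// mul0r.
- by rewrite !funenegE -EFin_max -EFinM -EFin_max maxr_pMl// mul0r mulNr.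
Qed.

End density.

(** * C^k functions and Schwarz's theorem *)

Section Ck_theory.
Context {R : realType} {d : nat}.
Implicit Types (f g : 'rV[R]_d -> R) (x v : 'rV[R]_d).

Lemma Ck_differentiable k f x : Ck k.+1 f -> differentiable f x.
Proof. by case. Qed.

Lemma Ck_derivable k f x v : Ck k.+1 f -> derivable f x v.
Proof. by move=> /Ck_differentiable df; exact: diff_derivable. Qed.

Lemma Ck_continuous k f : Ck k f -> continuous f.
Proof.
by case: k => [//|k] [df _] x; exact/differentiable_continuous/df.
Qed.

Lemma CkW k f : Ck k.+1 f -> Ck k f.
Proof.
elim: k f => [|k IH] f [df cf] //=.
  by move=> x; exact/differentiable_continuous/df.
by split=> // i; exact: IH.
Qed.

Lemma Ck_partial k i f : Ck k.+1 f -> Ck k (partial i f).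
Proof. by case=> _; exact. Qed.

Lemma partial_cst i (c : R) x : partial i (fun=> c) x = 0.
Proof. exact: derive_cst. Qed.

Lemma partialD i f g x : differentiable f x -> differentiable g x ->
  partial i (fun y => f y + g y) x = partial i f x + partial i g x.
Proof. by move=> df dg; apply: deriveD; exact: diff_derivable. Qed.

Lemma partialN i f x : differentiable f x ->
  partial i (fun y => - f y) x = - partial i f x.
Proof. by move=> df; apply: deriveN; exact: diff_derivable. Qed.

Lemma partialM i f g x : differentiable f x -> differentiable g x ->
  partial i (fun y => f y * g y) x = f x * partial i g x + g x * partial i f x.
Proof. by move=> df dg; apply: deriveM; exact: diff_derivable. Qed.

Lemma partial_sum i n (h : 'I_n -> 'rV[R]_d -> R) x :
  (forall j, differentiable (h j) x) ->
  partial i (fun y => \sum_(j < n) h j y) x = \sum_(j < n) partial i (h j) x.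
Proof.
move=> dh; rewrite /partial -derive_sum; last first.
  by move=> j; exact: diff_derivable.
by congr ('D__ _ _); apply/funext => y; rewrite fct_sumE.
Qed.

Lemma Ck_cst k (c : R) : @Ck R d k (fun=> c).
Proof.
elim: k c => [|k IH] c; first exact: cst_continuous.
split=> // i; rewrite (_ : partial i _ = (fun=> 0))//.
by apply/funext => x; exact: partial_cst.
Qed.

Lemma CkD k f g : Ck k f -> Ck k g -> Ck k (fun x => f x + g x).
Proof.
elim: k f g => [|k IH] f g.
  by move=> cf cg x; exact: (continuousD (cf x) (cg x)).
move=> [df pf] [dg pg].
split; first by move=> x; exact: (differentiableD (df x) (dg x)).
move=> i; rewrite (_ : partial i _ = fun x => partial i f x + partial i g x).
  by apply: IH; [exact: pf|exact: pg].
by apply/funext => x; exact: partialD.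
Qed.

Lemma CkN k f : Ck k f -> Ck k (fun x => - f x).
Proof.
elim: k f => [|k IH] f; first by move=> cf x; exact: (continuousN (cf x)).
move=> [df pf]; split; first by move=> x; exact: (differentiableN (df x)).
move=> i; rewrite (_ : partial i _ = fun x => - partial i f x).
  by apply: IH; exact: pf.
by apply/funext => x; exact: partialN.
Qed.

Lemma CkB k f g : Ck k f -> Ck k g -> Ck k (fun x => f x - g x).
Proof. by move=> cf cg; apply: CkD => //; exact: CkN. Qed.

Lemma CkM k f g : Ck k f -> Ck k g -> Ck k (fun x => f x * g x).
Proof.
elim: k f g => [|k IH] f g.
  by move=> cf cg x; exact: (continuousM (cf x) (cg x)).
move=> cf cg; have [df pf] := cf; have [dg pg] := cg.
split; first by move=> x; exact: (differentiableM (df x) (dg x)).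
move=> i.
rewrite (_ : partial i _ = fun x => f x * partial i g x + g x * partial i f x).
  by apply: CkD; apply: IH; [exact: CkW|exact: pg|exact: CkW|exact: pf].
by apply/funext => x; exact: partialM.
Qed.

Lemma CkX k n f : Ck k f -> Ck k (fun x => f x ^+ n).
Proof.
move=> cf; elim: n => [|n IH]; first exact: Ck_cst.
by under eq_fun do rewrite exprS; exact: CkM.
Qed.

Lemma Ck_sum k n (h : 'I_n -> 'rV[R]_d -> R) :
  (forall j, Ck k (h j)) -> Ck k (fun x => \sum_(j < n) h j x).
Proof.
elim: n h => [|n IH] h ch.
  by under eq_fun do rewrite big_ord0; exact: Ck_cst.
by under eq_fun do rewrite big_ord_recl; apply: CkD => //; exact: IH.
Qed.

Lemma Ck1_expRN f : Ck 1 f -> Ck 1 (fun x => expR (- f x)) /\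
  forall i x,
    partial i (fun y => expR (- f y)) x = - partial i f x * expR (- f x).
Proof.
move=> [df pf].
have dNf x : differentiable (fun y => - f y) x by exact: differentiableN.
have dexp (t : R) : differentiable expR t by exact/derivable1_diffP.
have pE i x :
    partial i (fun y => expR (- f y)) x = - partial i f x * expR (- f x).
  rewrite -partialN// /partial !deriveE//; last first.
    exact: (differentiable_comp (dNf x)).
  (* Writing the increment as a multiple of [1] lets linearity reduce the differential of [expR] to
     its derivative. *)
  rewrite (diff_comp (dNf x))//= -[X in 'd expR _ X]mulr1.
  rewrite [LHS]linearZ/=; congr (_ * _).
  by rewrite -[in RHS](@derive_val _ _ _ _ _ _ _ (is_derive_expR _)) deriveE.
split=> //; split=> [x|i]; first exact: (differentiable_comp (dNf x)).
rewrite (_ : partial i _ = fun x => - partial i f x * expR (- f x)); last first.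
  by apply/funext => x; exact: pE.
apply: (@CkM 0) => [|x]; first by apply: (@CkN 0); exact: pf.
exact: continuous_comp (differentiable_continuous (dNf x))
  (@continuous_expR R _).
Qed.

Lemma is_derive_shift_line f v x (t : R) : derivable f (t *: v + x) v ->
  is_derive t (1 : R) (fun s => f (s *: v + x)) ('D_v f (t *: v + x)).
Proof.
by apply: is_derive_eq_line => h; rewrite [h%:A]mulr1 scalerDl addrA.
Qed.

Lemma MVT_line f v x (t : R) : 0 < t ->
  (forall s : R, derivable f (s *: v + x) v) ->
  exists2 s, 0 < s < t & f (t *: v + x) - f x = 'D_v f (s *: v + x) * t.
Proof.
move=> t0 df; have gd s := is_derive_shift_line (df s).
have [s|s /[!in_itv] s0t] := MVT t0 (fun s _ => gd s).
  apply: continuous_subspaceT => {}s.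
  by apply/differentiable_continuous/derivable1_diffP; case: (gd s).
by rewrite scale0r add0r subr0 => ?; exists s.
Qed.

(** The mean value theorem is used twice: along [e i] for the increment [g] of [f] in direction
    [e j], then along [e j] for [partial i f]. *)
Lemma second_difference i j f x (t : R)
    (e := fun k => delta_mx ord0 k : 'rV[R]_d) :
  Ck 2 f -> 0 < t ->
  exists s r : R, [/\ 0 < s < t, 0 < r < t &
    f (t *: e i + (t *: e j + x)) - f (t *: e j + x) - (f (t *: e i + x) - f x)
    = partial j (partial i f) (r *: e j + (s *: e i + x)) * t ^+ 2].
Proof.
move=> cf t0.
pose g y := f (t *: e j + y) - f y.
have dft y : is_derive y (e i) (fun y => f (t *: e j + y))
    (partial i f (t *: e j + y)).
  apply: is_derive_eq_line (@Ck_derivable 1 f (t *: e j + y) (e i) cf) => h.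
  by rewrite addrCA.
have dg y : is_derive y (e i) g (partial i f (t *: e j + y) - partial i f y).
  apply: is_deriveB; apply: derivableP; exact: (@Ck_derivable 1 f).
have [s s0t gE] := MVT_line t0
  (fun s => @ex_derive _ _ _ _ _ _ _ (dg (s *: e i + x))).
have [r r0t pE] := @MVT_line (partial i f) (e j) (s *: e i + x) t t0
  (fun r => @Ck_derivable 0 _ _ _ (Ck_partial i cf)).
exists s, r; split=> //.
rewrite [t *: e i + (t *: e j + x)]addrCA.
transitivity (g (t *: e i + x) - g x); first by rewrite /g; ring.
rewrite gE.
by rewrite (derive_val (is_derive := dg _)) pE expr2 mulrA.
Qed.

(* The second difference of [f] along [e i] and [e j] is symmetric, and by
   [second_difference] it is [t ^+ 2] times a value, near [x], of either mixed
   derivative. *)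
Lemma partialC i j f x : Ck 2 f ->
  partial i (partial j f) x = partial j (partial i f) x.
Proof.
move=> cf; apply/eqP; rewrite -subr_eq0 -normr_le0.
apply/ler_addgt0Pl => eps eps0.
rewrite addr0; have e20 : 0 < eps / 2 by rewrite divr_gt0.
have near_cont k l : \forall y \near x,
    `|partial k (partial l f) x - partial k (partial l f) y| < eps / 2.
  have cc : {for x, continuous (partial k (partial l f))}.
    exact: (Ck_continuous (Ck_partial k (Ck_partial l cf))).
  by move/cvgrPdist_lt : cc; exact.
have : nbhs x [set y | `|partial i (partial j f) x - partial i (partial j f) y|
      < eps / 2 /\ `|partial j (partial i f) x - partial j (partial i f) y|
      < eps / 2] by apply: filterI; exact: near_cont.
move=> /nbhs_ballP[dl /= dl0 H].
pose e k : 'rV[R]_d := delta_mx ord0 k.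
(* This scale keeps the intermediate points of [second_difference], for either order of the
   directions, in the ball of radius [dl]. *)
pose t := dl / (`|e i| + `|e j| + 1).
have c0 : 0 < `|e i| + `|e j| + 1 by rewrite ltr_wpDl// addr_ge0.
have t0 : 0 < t by rewrite divr_gt0.
have small k l (s r : R) : `|e k| + `|e l| + 1 = `|e i| + `|e j| + 1 ->
    0 < s < t -> 0 < r < t -> ball x dl (r *: e l + (s *: e k + x)).
  move=> kl /andP[s0 st] /andP[r0 rt]; rewrite -ball_normE/=.
  rewrite addrA opprD addrCA subrr addr0 normrN (le_lt_trans (ler_normD _ _))//.
  rewrite !normrZ !gtr0_norm// -(divfK (lt0r_neq0 c0) dl) -/t -kl !mulrDr mulr1.
  have lin (a b c u v : R) : a <= u -> b <= v -> 0 < c -> a + b < v + u + c.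
    by move=> au bv c0'; lra.
  by apply: lin => //; rewrite ler_wpM2r// ltW.
have close (a b c : R) : `|a - c| < eps / 2 -> `|b - c| < eps / 2 ->
    `|a - b| <= eps.
  move=> ac bc; rewrite (splitr eps) -(subrKA c) ltW//.
  by rewrite (le_lt_trans (ler_normD _ _))// ltrD// distrC.
have swap (a b c z : R) : a - b - (c - z) = a - c - (b - z) by ring.
have [s [r [s0 r0 E1]]] := second_difference i j x cf t0.
have [s' [r' [s'0 r'0 E2]]] := second_difference j i x cf t0.
(* Both second differences are the same four-term sum, so the two mixed derivatives agree at their
   respective intermediate points. *)
have E : partial j (partial i f) (r *: e j + (s *: e i + x)) =
         partial i (partial j f) (r' *: e i + (s' *: e j + x)).
  apply: (@mulIf _ (t ^+ 2)); first by rewrite expf_neq0// lt0r_neq0.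
  apply: etrans (esym E1) (etrans _ E2); rewrite [LHS]swap.
  by congr (f _ - _ - _); exact: addrCA.
have [_ /= B1] := H _ (small i j s r erefl s0 r0).
have [/= B2 _] := H _ (small j i s' r' (congr1 (+%R^~ 1) (addrC _ _)) s'0 r'0).
by apply: close B2 _; rewrite -E; exact: B1.
Qed.

End Ck_theory.

(** * Integration by parts for the Gibbs measure *)

Section compact_support.
Context {R : realType} {d : nat}.
Implicit Types (f g : 'rV[R]_d -> R).

(* Compact support, stated through the cubes, which are what the integrability
   criterion uses. *)
Definition csupp f := exists B, forall x, ~ cube B x -> f x = 0.

Lemma csuppW f g : csupp f -> (forall x, f x = 0 -> g x = 0) -> csupp g.
Proof. by move=> [B fB] fg; exists B => x /fB/fg. Qed.

Lemma csupp2 f g h : csupp f -> csupp g ->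
  (forall x, f x = 0 -> g x = 0 -> h x = 0) -> csupp h.
Proof.
move=> [B fB] [C gC] fgh; exists (Num.max B C) => x xBC; apply: fgh.
  by apply: fB => xB; apply: xBC => i; rewrite le_max xB.
by apply: gC => xC; apply: xBC => i; rewrite le_max xC orbT.
Qed.

Lemma csupp_sum n (h : 'I_n -> 'rV[R]_d -> R) :
  (forall j, csupp (h j)) -> csupp (fun x => \sum_(j < n) h j x).
Proof.
elim: n h => [|n IH] h ch; first by exists 0 => x _; rewrite big_ord0.
apply: (csupp2 (ch ord0) (IH _ (fun j => ch (lift ord0 j)))) => x h0 hS.
by rewrite big_ord_recl h0 hS addr0.
Qed.

Lemma csupp_partial i f : csupp f -> csupp (partial i f).
Proof.
move=> [B fB]; exists B => x /near_notin_cube Bx.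
by apply: partial_eq0; apply: filterS Bx.
Qed.

Lemma compact_csupp f : compact (closure [set x | f x != 0]) -> csupp f.
Proof.
move=> /compact_bounded[M [_ MA]]; exists (M + 1) => x xM.
apply/eqP/negP => /negP fx; apply: xM => i.
have : `|x| <= M + 1 by apply: MA; [rewrite ltrDl|exact: subset_closure].
(* The norm of a row is the maximum of its absolute entries, hence dominates coordinate [i]. *)
apply: le_trans; rewrite [leRHS]/Num.norm/= mx_normrE; apply/bigmax_geP; right.
by exists (ord0, i).
Qed.

Lemma bounded_csupp f :
  continuous f -> csupp f -> exists M, forall x, `|f x| <= M.
Proof.
move=> cf [B fB].
have cB : compact (@cube R d B).
  rewrite (_ : cube B = [set v | forall i, `[- B, B]%classic (v ord0 i)]).
    apply: (@rV_compact _ _ (fun=> `[- B, B]%classic)) => i.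
    exact: segment_compact.
  by apply/seteqP; split=> v /= vB i; have := vB i;
    rewrite /= in_itv/= ler_norml.
have /compact_bounded[M [_ fM]] : compact (f @` cube B).
  by apply: continuous_compact => //; exact: continuous_subspaceT.
exists (Num.max 0 (M + 1)) => x; have [xB|xB] := pselect (cube B x).
  by rewrite le_max (fM (M + 1)) ?orbT ?ltrDl//; exists x.
by rewrite fB// normr0 le_max lexx.
Qed.

End compact_support.

Section gibbs_ibp.
Context {R : realType} {d : nat} (U : 'rV[R]_d -> R).
Hypotheses (U1 : Ck 1 U) (Z_fin : (0 < partition_function U < +oo)%E).

Let mU : measurable_fun setT U.
Proof. exact: continuous_measurable_rV (Ck_continuous U1). Qed.

(** The measure structure on [gibbs U] depends on a proof that [U] is measurable; here continuity
    provides it. *)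
Definition gibbs_measure : {measure set 'rV[R]_d -> \bar R} :=
  Defs_gibbs__canonical__measure_function_Measure mU.

Let Z := fine (partition_function U).
Let density x := Z^-1 * expR (- U x).

Let Z0 : 0 < Z.
Proof. exact: fine_gt0. Qed.

Let density1 : Ck 1 density.
Proof. by apply: CkM; [exact: Ck_cst|exact: (Ck1_expRN U1).1]. Qed.

Lemma gibbs_measure_lty : (gibbs_measure setT < +oo)%E.
Proof.
have mexp : measurable_fun setT (fun x => expR (- U x)).
  exact: continuous_measurable_rV (Ck_continuous (Ck1_expRN U1).1).
rewrite /= /gibbs; under eq_integral do rewrite EFinM.
rewrite ge0_integralZl//; last 2 first.
- exact/measurable_EFinP.
- by rewrite lee_fin invr_ge0 ltW.
apply: lte_mul_pinfty; rewrite ?lee_fin ?invr_ge0 ?(ltW Z0)//.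
by case/andP: Z_fin.
Qed.

Lemma integrable_gibbs f M : continuous f -> (forall x, `|f x| <= M) ->
  gibbs_measure.-integrable setT (EFin \o f).
Proof.
move=> cf fM; apply: measurable_bounded_integrable => //.
- exact: gibbs_measure_lty.
- exact: continuous_measurable_rV.
- exists M; split; first exact: num_real.
  by move=> N /ltW MN x _; exact: le_trans (fM x) MN.
Qed.

(** Times the density, the integrand is the partial derivative of [f] times the density, whose
    Lebesgue integral is zero. *)
Lemma gibbs_ibp i f : Ck 1 f -> csupp f ->
  (\int[gibbs_measure]_x (partial i f x - f x * partial i U x)%:E = 0)%E.
Proof.
move=> f1 fs.
have c0 : continuous (fun x => partial i f x - f x * partial i U x).
  apply: (@CkB _ _ 0); first exact: Ck_partial f1.
  by apply: (@CkM _ _ 0); [exact: Ck_continuous f1|exact: Ck_partial U1].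
have s0 : csupp (fun x => partial i f x - f x * partial i U x).
  apply: csupp2 fs (csupp_partial i fs) _ => x -> ->.
  by rewrite mul0r subrr.
have [M fM] := bounded_csupp c0 s0.
have mdens : measurable_fun setT density.
  exact: continuous_measurable_rV (Ck_continuous density1).
rewrite (@integral_density _ _ _ (@lebesgue_rV R d) _ density)//; last first.
  exact: integrable_gibbs fM.
  by move=> x; rewrite mulr_ge0 ?expR_ge0// invr_ge0 ltW.
pose F x := f x * density x.
have F1 : Ck 1 F by exact: CkM.
have Fs : csupp F by apply: csuppW fs _ => x; rewrite /F => ->; rewrite mul0r.
have [N FN] := bounded_csupp (Ck_partial i F1) (csupp_partial i Fs).
have [B FB] := Fs.
rewrite -[RHS](@integral_partial_eq0 _ _ i F B N)//.
- apply: eq_integral => x _; congr EFin; rewrite /F.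
  have diff1 h : Ck 1 h -> differentiable h x by case.
  rewrite partialM; [|exact: diff1..].
  rewrite partialM; [|exact/diff1/Ck_cst|exact/diff1/(Ck1_expRN U1).1].
  by rewrite partial_cst (Ck1_expRN U1).2 /density; ring.
- by move=> x; exact: Ck_derivable F1.
- exact: Ck_partial F1.
Qed.

End gibbs_ibp.

(** * The Bochner identity *)

(** The Bochner computation at one point: [f i], [u i], [a i j], [b i j], [c i j], [h i j] stand for
    [F_i], [d_i U], [d_i F_j], [d_i d_j F_j], [d_i d_j F_i], [d_i d_j U], and [A0] for the weighted
    divergence of [F]. *)
Lemma bochner_algebra (R : comNzRingType) (d : nat) (f u : 'I_d -> R)
    (a b c h : 'I_d -> 'I_d -> R)
    (A0 := \sum_(i < d) (a i i - f i * u i)) :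
  (forall i j, c i j = b j i) ->
  \sum_(i < d) (f i * (\sum_(j < d) (b i j - (f j * h i j + u j * a i j)))
     + A0 * a i i - (\sum_(j < d) (f j * c i j + a j i * a i j))
     - (f i * A0 - \sum_(j < d) f j * a j i) * u i) =
  A0 ^+ 2 - \sum_(i < d) \sum_(j < d) a i j * a j i
  - \sum_(i < d) \sum_(j < d) f i * f j * h i j.
Proof.
(* The second derivatives of [F] and the mixed terms in [u] and [a] enter only through
   [X i j - X j i], whose double sum is zero. *)
move=> cb; pose X i j := f i * b i j - f i * u j * a i j.
have exX : \sum_(i < d) \sum_(j < d) (X i j - X j i) = 0.
  under eq_bigr do rewrite sumrB.
  by rewrite sumrB [X in _ - X]exchange_big subrr.
have A0E : A0 ^+ 2 = \sum_(i < d) (a i i - f i * u i) * A0.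
  by rewrite expr2 {1}/A0 mulr_suml.
clearbody A0.
(* Once this zero is subtracted, the identity holds for each [i] separately, with [A0] treated as an
   opaque scalar. *)
rewrite A0E -!sumrB -[LHS]subr0 -[X in _ - X = _]exX -sumrB.
apply: eq_bigr => i _.
rewrite mulr_sumr !mulrBl mulr_suml.
have -> : \sum_(j < d) (X i j - X j i) =
  (\sum_(j < d) f i * (b i j - (f j * h i j + u j * a i j)))
  - (\sum_(j < d) (f j * c i j + a j i * a i j)) +
  (\sum_(j < d) f j * a j i * u i) +
  (\sum_(j < d) a i j * a j i) + \sum_(j < d) f i * f j * h i j.
  rewrite -sumrB -!big_split/=; apply: eq_bigr => j _; rewrite cb /X; ring.
ring.
Qed.

(** * Pointwise inequalities *)

Section euclidean.
Context {R : realType} {d : nat}.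

Lemma enorm_sqr (v : 'rV[R]_d) : enorm v ^+ 2 = \sum_(i < d) v ord0 i ^+ 2.
Proof.
by rewrite sqr_sqrtr; [|apply: sumr_ge0 => i _; exact: sqr_ge0].
Qed.

Lemma frobenius_sqr (A : 'M[R]_d) :
  frobenius A ^+ 2 = \sum_(i < d) \sum_(j < d) A j i ^+ 2.
Proof.
have trE : \tr (A^T *m A) = \sum_(i < d) \sum_(j < d) A j i ^+ 2.
  apply: eq_bigr => i _; rewrite mxE; apply: eq_bigr => j _.
  by rewrite mxE expr2.
rewrite sqr_sqrtr trE//.
by apply: sumr_ge0 => i _; apply: sumr_ge0 => j _; exact: sqr_ge0.
Qed.

(** At a point, [a], [S], [p], [H], [h] are [s], its gradient, the gradient and Hessian of [g], and
    the Hessian of [U]. Each of the two error sums in [young] costs at most [2 * M ^+ 2] times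
    [a ^+ 2 * P], whence the constant 4. *)
Lemma bochner_lower_bound (H h : 'I_d -> 'I_d -> R) (S p : 'I_d -> R)
    (a M K : R) :
  (forall i j, H i j = H j i) -> \sum_(i < d) S i ^+ 2 <= M ^+ 2 ->
  0 <= a ^+ 2 * (\sum_(i < d) \sum_(j < d) p i * p j * h i j)
       + K * \sum_(i < d) p i ^+ 2 ->
  2^-1 * (a ^+ 4 * \sum_(i < d) \sum_(j < d) H i j ^+ 2) <=
  \sum_(i < d) \sum_(j < d) (a ^+ 2 * H i j + 2 * a * S i * p j)
                          * (a ^+ 2 * H j i + 2 * a * S j * p i)
  + \sum_(i < d) \sum_(j < d) a ^+ 2 * p i * (a ^+ 2 * p j) * h i j
  + (4 * M ^+ 2 + K) * (a ^+ 2 * \sum_(i < d) p i ^+ 2).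
Proof.
move=> Hsym SM pK; set P := \sum_(i < d) p i ^+ 2.
have P0 : 0 <= P by apply: sumr_ge0 => i _; exact: sqr_ge0.
have W : \sum_(i < d) \sum_(j < d) S i ^+ 2 * p j ^+ 2 <= M ^+ 2 * P.
  under eq_bigr do rewrite -mulr_sumr.
  by rewrite -mulr_suml ler_wpM2r.
have W' : \sum_(i < d) \sum_(j < d) S j ^+ 2 * p i ^+ 2 <= M ^+ 2 * P.
  by rewrite exchange_big.
have -> : \sum_(i < d) \sum_(j < d) a ^+ 2 * p i * (a ^+ 2 * p j) * h i j =
    a ^+ 2 * (a ^+ 2 * \sum_(i < d) \sum_(j < d) p i * p j * h i j).
  rewrite !mulr_sumr; apply: eq_bigr => i _; rewrite !mulr_sumr.
  by apply: eq_bigr => j _; ring.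
have young : 2^-1 * (a ^+ 4 * \sum_(i < d) \sum_(j < d) H i j ^+ 2) <=
  \sum_(i < d) \sum_(j < d) (a ^+ 2 * H i j + 2 * a * S i * p j)
                          * (a ^+ 2 * H j i + 2 * a * S j * p i)
  + 2 * a ^+ 2 * \sum_(i < d) \sum_(j < d) S i ^+ 2 * p j ^+ 2
  + 2 * a ^+ 2 * \sum_(i < d) \sum_(j < d) S j ^+ 2 * p i ^+ 2.
  rewrite !mulr_sumr -!big_split/=; apply: ler_sum => i _.
  rewrite !mulr_sumr -!big_split/=; apply: ler_sum => j _.
  rewrite -(Hsym i j) -subr_ge0.
  set u := a ^+ 2 * H i j.
  rewrite (_ : _ - _ = 2^-1 * (u + 2 * (a * S i * p j + a * S j * p i)) ^+ 2).
    by rewrite mulr_ge0 ?invr_ge0 ?sqr_ge0.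
  by rewrite /u; field.
have combine (b w w' M2 q t z : R) : 0 <= b -> w <= M2 * P -> w' <= M2 * P ->
    0 <= b * q + K * P -> z <= t + 2 * b * w + 2 * b * w' ->
    z <= t + b * (b * q) + (4 * M2 + K) * (b * P).
  move=> b0 wP w'P q0 zt.
  have := ler_wpM2l b0 wP; have := ler_wpM2l b0 w'P; have := mulr_ge0 b0 q0.
  lra.
exact: combine (sqr_ge0 a) W W' pK young.
Qed.

End euclidean.

Section real_inequalities.
Context {R : realFieldType}.

(** Young's inequality for [(g - c) * L]. The right side is grouped so that [g * L + e] and
    [- c * L] will both have integral zero. *)
Lemma energy_pointwise (m g L e c : R) : 0 < m ->
  e <= (g * L + e) + (- c * L + (m / 2 * (g - c) ^+ 2 + (2 * m)^-1 * L ^+ 2)).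
Proof.
move=> m0; rewrite -subr_ge0.
rewrite (_ : _ - _ = (2 * m)^-1 * (m * (g - c) + L) ^+ 2).
  by rewrite mulr_ge0 ?sqr_ge0// invr_ge0 mulr_ge0// ltW.
by field; rewrite lt0r_neq0.
Qed.

(** The hypothesis on [v] bounds [m / 2 * v] by half of [e], which is absorbed on the left. *)
Lemma absorb_half (m e v l : R) : 0 < m -> m * v <= e ->
  e <= m / 2 * v + (2 * m)^-1 * l -> m * e <= l.
Proof.
move=> m0 ve; have -> : (2 * m)^-1 * l = l / m / 2 by field; rewrite lt0r_neq0.
move=> H; have : e <= l / m by lra.
by rewrite ler_pdivlMr// mulrC.
Qed.

Lemma combine_bounds (C m n e l : R) : 0 < m -> 0 <= C -> m * e <= l ->
  2^-1 * n <= l + C * e -> n <= 2 * (1 + C / m) * l.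
Proof.
move=> m0 C0 el nl.
have : C * e <= C * (l / m) by rewrite ler_wpM2l// ler_pdivlMr// mulrC.
have -> : 2 * (1 + C / m) * l = 2 * (l + C * (l / m)).
  by field; rewrite lt0r_neq0.
lra.
Qed.

End real_inequalities.

(** * Integrated Bochner identity *)

Section bochner.
Context {R : realType} {d : nat} (U : 'rV[R]_d -> R).
Hypotheses (U2 : Ck 2 U) (Z_fin : (0 < partition_function U < +oo)%E).

Let U1 : Ck 1 U := CkW U2.
Let mu := gibbs_measure U1.
Let I (f : 'rV[R]_d -> R) : R := \int[mu]_x f x.

(** A class closed under sums and products and integrable for the finite measure [mu]. Unlike
    compactly supported functions, it contains constants, hence [g - c]. *)
Definition bounded_continuous (f : 'rV[R]_d -> R) :=
  continuous f /\ exists M, forall x, `|f x| <= M.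

Lemma Ck_bounded_continuous k f : Ck k f -> csupp f -> bounded_continuous f.
Proof.
by move=> /Ck_continuous cf sf; split => //; exact: bounded_csupp.
Qed.

Lemma bounded_continuous_cst c : bounded_continuous (fun=> c).
Proof. by split; [exact: cst_continuous|exists `|c|]. Qed.

Lemma bounded_continuousD f g : bounded_continuous f -> bounded_continuous g ->
  bounded_continuous (fun x => f x + g x).
Proof.
move=> [cf [M fM]] [cg [N gN]]; split; first exact: (@CkD _ _ 0).
by exists (M + N) => x; rewrite (le_trans (ler_normD _ _))// lerD.
Qed.

Lemma bounded_continuousM f g : bounded_continuous f -> bounded_continuous g ->
  bounded_continuous (fun x => f x * g x).
Proof.
move=> [cf [M fM]] [cg [N gN]]; split; first exact: (@CkM _ _ 0).
by exists (M * N) => x; rewrite normrM ler_pM.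
Qed.

Lemma integrable_bounded_continuous f : bounded_continuous f ->
  mu.-integrable setT (EFin \o f).
Proof. by move=> [cf [M fM]]; exact: integrable_gibbs cf fM. Qed.

Lemma EFin_integral_gibbs f : bounded_continuous f ->
  (\int[mu]_x (f x)%:E = (I f)%:E)%E.
Proof.
move=> /integrable_bounded_continuous fi; rewrite /I /Rintegral fineK//.
exact: integrable_fin_num fi.
Qed.

Lemma integral_gibbsD f g : bounded_continuous f -> bounded_continuous g ->
  I (fun x => f x + g x) = I f + I g.
Proof.
by move=> bf bg; apply: RintegralD => //; exact: integrable_bounded_continuous.
Qed.

Lemma integral_gibbsZ k f : bounded_continuous f ->
  I (fun x => k * f x) = k * I f.
Proof.
by move=> bf; apply: RintegralZl => //; exact: integrable_bounded_continuous.
Qed.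

Lemma le_integral_gibbs f g : bounded_continuous f -> bounded_continuous g ->
  (forall x, f x <= g x) -> I f <= I g.
Proof.
move=> bf bg fg.
by apply: le_Rintegral => //; exact: integrable_bounded_continuous.
Qed.

Lemma gibbs_sqnorm2E f : bounded_continuous f ->
  gibbs_sqnorm2 U f = (I (fun x => f x ^+ 2))%:E.
Proof.
move=> bf; have bf2 : bounded_continuous (fun x => f x ^+ 2).
  under eq_fun do rewrite expr2.
  exact: bounded_continuousM.
rewrite -EFin_integral_gibbs//; apply: eq_integral => x _.
by rewrite real_normK// num_real.
Qed.

(* Minus the adjoint of the gradient in L^2(mu). *)
Definition adjoint_div (F : 'I_d -> 'rV[R]_d -> R) x : R :=
  \sum_(i < d) (partial i (F i) x - F i x * partial i U x).

(** The integrand of [int L^2 - tr((DF)^2) - <F, U'' F>] for a general field [F], with [L] its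
    weighted divergence. *)
Definition bochner_term (F : 'I_d -> 'rV[R]_d -> R) x : R :=
  adjoint_div F x ^+ 2
  - \sum_(i < d) \sum_(j < d) partial i (F j) x * partial j (F i) x
  - \sum_(i < d) \sum_(j < d) F i x * F j x * partial i (partial j U) x.

Section field.
Variable F : 'I_d -> 'rV[R]_d -> R.
Hypothesis Fs : forall i, csupp (F i).

Lemma csupp_adjoint_div : csupp (adjoint_div F).
Proof.
apply: csupp_sum => i; apply: csupp2 (Fs i) (csupp_partial i (Fs i)) _.
by move=> x -> ->; rewrite mul0r subrr.
Qed.

(** One derivative is lost on [F] and one on [U]; the bound on [k] reflects that [U] is C^2. *)
Lemma Ck_adjoint_div k : (k <= 1)%N -> (forall i, Ck k.+1 (F i)) ->
  Ck k (adjoint_div F).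
Proof.
move=> k1 Fk; apply: Ck_sum => i; apply: CkB; first exact: Ck_partial (Fk i).
apply: CkM; first exact: CkW (Fk i).
by case: k k1 Fk => [_ _|[|//] _ _]; apply: Ck_partial.
Qed.

Lemma integral_adjoint_div : (forall i, Ck 1 (F i)) -> I (adjoint_div F) = 0.
Proof.
move=> F1; rewrite /I /Rintegral.
under eq_integral do rewrite /adjoint_div -sumEFin.
rewrite integral_sum//; last first.
  move=> i; apply: integrable_bounded_continuous.
  apply: (@Ck_bounded_continuous 0).
    apply: CkB; first exact: Ck_partial (F1 i).
    exact: CkM (CkW (F1 i)) (Ck_partial i U1).
  apply: csupp2 (Fs i) (csupp_partial i (Fs i)) _.
  by move=> x -> ->; rewrite mul0r subrr.
by rewrite big1// => i _; exact: gibbs_ibp.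
Qed.

End field.

Section bochner_field.
Variable F : 'I_d -> 'rV[R]_d -> R.
Hypotheses (Fs : forall i, csupp (F i)) (F2 : forall i, Ck 2 (F i)).

Let A := adjoint_div F.

Let A1 : Ck 1 A.
Proof. exact: (@Ck_adjoint_div F 1). Qed.

(** The field [A F - (F . grad) F]: in its weighted divergence the second derivatives of [F]
    cancel. *)
Let G i x := F i x * A x - \sum_(j < d) F j x * partial j (F i) x.

Let partialA i x : partial i A x = \sum_(j < d)
  (partial i (partial j (F j)) x
   - (F j x * partial i (partial j U) x + partial j U x * partial i (F j) x)).
Proof.
have d1 h : Ck 1 h -> differentiable h x by case.
have c1 j := Ck_partial j (F2 j); have cU j := Ck_partial j U2.
have cFU j : Ck 1 (fun y => - (F j y * partial j U y)).
  by apply: CkN; apply: CkM; [exact: CkW (F2 j)|exact: cU].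
rewrite /A /adjoint_div partial_sum; last first.
  by move=> j; apply: d1; apply: CkD; [exact: c1|exact: cFU].
apply: eq_bigr => j _; rewrite partialD; [|exact/d1/c1|exact/d1/cFU].
rewrite partialN; last first.
  by apply: d1; apply: CkM; [exact: CkW (F2 j)|exact: cU].
by rewrite partialM; [|exact/d1/CkW/F2|exact/d1/cU].
Qed.

Let partialG i x : partial i (G i) x =
  F i x * partial i A x + A x * partial i (F i) x
  - \sum_(j < d) (F j x * partial i (partial j (F i)) x
                  + partial j (F i) x * partial i (F j) x).
Proof.
have d1 h : Ck 1 h -> differentiable h x by case.
have cF j : Ck 1 (F j) := CkW (F2 j).
have cFF j : Ck 1 (fun y => F j y * partial j (F i) y).
  by apply: CkM; [exact: cF|exact: Ck_partial (F2 i)].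
have cS : Ck 1 (fun y => \sum_(j < d) F j y * partial j (F i) y).
  exact: Ck_sum cFF.
have cFA : Ck 1 (fun y => F i y * A y) := CkM (cF i) A1.
rewrite /G partialD; [|exact: d1 cFA|exact: d1 (CkN cS)].
rewrite partialN; last exact: d1 cS.
rewrite partialM; [|exact: d1 (cF i)|exact: d1 A1].
rewrite (partial_sum i (h := fun j y => F j y * partial j (F i) y)); last first.
  by move=> j; exact/d1/cFF.
congr (_ - _); apply: eq_bigr => j _.
by rewrite partialM; [|exact: d1 (cF j)|exact: d1 (Ck_partial j (F2 i))].
Qed.

Let adjoint_divG : adjoint_div G = bochner_term F.
Proof.
apply/funext => x.
rewrite /adjoint_div; under eq_bigr do rewrite partialG partialA.
apply: (@bochner_algebra R d (fun i => F i x) (fun i => partial i U x)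
  (fun i j => partial i (F j) x) (fun i j => partial i (partial j (F j)) x)
  (fun i j => partial i (partial j (F i)) x)
  (fun i j => partial i (partial j U) x)) => i j.
exact: partialC (F2 i).
Qed.

Let Gs i : csupp (G i).
Proof.
apply: (csupp2 (Fs i) (csupp_sum (fun j =>
    csuppW (g := fun x => F j x * partial j (F i) x) (Fs j) _))).
  by move=> j x ->; rewrite mul0r.
by move=> x Fx; rewrite /G Fx mul0r => ->; rewrite subrr.
Qed.

Let G1 i : Ck 1 (G i).
Proof.
apply: CkB; first exact: CkM (CkW (F2 i)) A1.
by apply: Ck_sum => j; exact: CkM (CkW (F2 j)) (Ck_partial j (F2 i)).
Qed.

Lemma integral_bochner : I (bochner_term F) = 0.
Proof. by rewrite -adjoint_divG integral_adjoint_div. Qed.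

Lemma bounded_continuous_bochner : bounded_continuous (bochner_term F).
Proof.
rewrite -adjoint_divG; apply: (@Ck_bounded_continuous 0).
  exact: (@Ck_adjoint_div G 0).
exact: csupp_adjoint_div.
Qed.

End bochner_field.

(** * The weighted Hessian estimate *)

Section weighted_hessian.
Variables (s g : 'rV[R]_d -> R) (m MD K : R).
Hypotheses (s2 : Ck 2 s) (g3 : Ck 3 g) (gs : csupp g) (m0 : 0 < m).

Let F i x := s x ^+ 2 * partial i g x.
Let L := adjoint_div F.

Let Fs i : csupp (F i).
Proof.
by apply: csuppW (csupp_partial i gs) _ => x gx; rewrite /F gx mulr0.
Qed.

Let F2 i : Ck 2 (F i).
Proof. exact: CkM (CkX 2 s2) (Ck_partial i g3). Qed.

Lemma generatorE : generator U s g = L.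
Proof.
apply/funext => x; rewrite /generator /divergence /dotv mulr_sumr -sumrB.
apply: eq_bigr => i _; rewrite !mxE mulrCA [in RHS]mulrC.
congr (partial i _ x - _).
by apply/funext => y; rewrite !mxE.
Qed.

Let E x := s x ^+ 2 * enorm (grad g x) ^+ 2.

(** This form is free of the square root in [enorm], so the regularity of [E] can be read off. *)
Let EE x : E x = \sum_(i < d) F i x * partial i g x.
Proof.
rewrite /E enorm_sqr mulr_sumr; apply: eq_bigr => i _.
by rewrite mxE /F expr2 mulrA.
Qed.

Let bcL : bounded_continuous L.
Proof.
apply: (@Ck_bounded_continuous 0).
  exact: (@Ck_adjoint_div F 0) (fun i => CkW (F2 i)).
exact: csupp_adjoint_div.
Qed.

Let bcE : bounded_continuous E.
Proof.
rewrite (_ : E = fun x => \sum_(i < d) F i x * partial i g x);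
  last exact/funext/EE.
apply: (@Ck_bounded_continuous 2).
  by apply: Ck_sum => i; exact: CkM (F2 i) (Ck_partial i g3).
by apply: csupp_sum => i; apply: csuppW (Fs i) _ => x ->; rewrite mul0r.
Qed.

Let bcg : bounded_continuous g.
Proof. exact: Ck_bounded_continuous g3 gs. Qed.

(** By the product rule, the integrand is the weighted divergence of the field [g F]. *)
Let integral_energy : I (fun x => g x * L x + E x) = 0.
Proof.
pose G i x := g x * F i x.
have g1 : Ck 1 g := CkW (CkW g3).
rewrite (_ : (fun x => _) = adjoint_div G).
  apply: integral_adjoint_div => i; last exact: CkM g1 (CkW (F2 i)).
  by apply: csuppW gs _ => x gx; rewrite /G gx mul0r.
have d1 h x : Ck 1 h -> differentiable h x by case.
apply/funext => x; rewrite EE /L /adjoint_div mulr_sumr -big_split/=.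
apply: eq_bigr => i _.
have -> : partial i (G i) x = g x * partial i (F i) x + F i x * partial i g x.
  by apply: partialM; apply: d1; [exact: g1|exact: CkW (F2 i)].
by rewrite /G; ring.
Qed.

Lemma energy_le c :
  m * I (fun x => (g x - c) ^+ 2) <= I E -> m * I E <= I (fun x => L x ^+ 2).
Proof.
move=> poincare.
have bcgc : bounded_continuous (fun x => (g x - c) ^+ 2).
  under eq_fun do rewrite expr2.
  by apply: bounded_continuousM; apply: bounded_continuousD => //;
    exact: bounded_continuous_cst.
have bcL2 : bounded_continuous (fun x => L x ^+ 2).
  under eq_fun do rewrite expr2.
  exact: bounded_continuousM.
have bcgLE : bounded_continuous (fun x => g x * L x + E x).
  by apply: bounded_continuousD => //; exact: bounded_continuousM.
have bcc k :
    forall f, bounded_continuous f -> bounded_continuous (fun x => k * f x).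
  by move=> f; apply: bounded_continuousM; exact: bounded_continuous_cst.
(* After integration the bracket [g L + E] and the term in [c] drop out, leaving the two Young
   terms. *)
have : I E <= I (fun x => (g x * L x + E x) + (- c * L x +
    (m / 2 * (g x - c) ^+ 2 + (2 * m)^-1 * L x ^+ 2))).
  apply: le_integral_gibbs => //.
    do 3 (apply: bounded_continuousD; first by [exact: bcgLE|exact: bcc]).
    exact: bcc.
  by move=> x; exact: energy_pointwise.
rewrite integral_gibbsD//; last first.
  do 2 (apply: bounded_continuousD; first exact: bcc); exact: bcc.
rewrite integral_energy add0r integral_gibbsD; [|exact: bcc|]; last first.
  by apply: bounded_continuousD; exact: bcc.
rewrite integral_gibbsZ// integral_adjoint_div//; last first.
  by move=> i; exact: CkW (F2 i).
rewrite mulr0 add0r integral_gibbsD; [|exact: bcc..].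
rewrite !integral_gibbsZ// => H.
exact: absorb_half poincare H.
Qed.

Hypotheses (K0 : 0 <= K) (sMD : forall x, enorm (grad s x) <= MD)
  (UK : forall x, psd (s x ^+ 2 *: hess U x - (- K) *: 1%:M)).

Let N x := s x ^+ 4 * frobenius (hess g x) ^+ 2.

Let NE x :
  N x = s x ^+ 4 * \sum_(i < d) \sum_(j < d) partial i (partial j g) x ^+ 2.
Proof.
rewrite /N frobenius_sqr; congr (_ * _).
by apply: eq_bigr => i _; apply: eq_bigr => j _; rewrite mxE.
Qed.

Let bcN : bounded_continuous N.
Proof.
rewrite (_ : N = fun x => s x ^+ 4 *
    \sum_(i < d) \sum_(j < d) partial i (partial j g) x ^+ 2);
  last exact/funext/NE.
apply: (@Ck_bounded_continuous 1).
  apply: CkM (CkX 4 (CkW s2)) _; apply: Ck_sum => i; apply: Ck_sum => j.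
  have c := Ck_partial i (Ck_partial j g3).
  exact: (@CkX _ _ 1 2 (partial i (partial j g))).
have S : csupp (fun x =>
    \sum_(i < d) \sum_(j < d) partial i (partial j g) x ^+ 2).
  apply: csupp_sum => i; apply: csupp_sum => j.
  apply: csuppW (csupp_partial i (csupp_partial j gs)) _ => x ->.
  by rewrite expr0n.
by apply: csuppW S _ => x ->; rewrite mulr0.
Qed.

Let partialF i j x : partial i (F j) x =
  s x ^+ 2 * partial i (partial j g) x
  + 2 * s x * partial i s x * partial j g x.
Proof.
have d1 h : Ck 1 h -> differentiable h x by case.
have s1 := CkW s2; have pg := CkW (Ck_partial j g3).
rewrite partialM; [|exact: d1 (CkX 2 s1)|exact: d1 pg].
rewrite (_ : partial i (fun y => s y ^+ 2) x = 2 * s x * partial i s x);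
    last first.
  under eq_fun do rewrite expr2.
  by rewrite partialM; [ring|exact: d1 s1..].
ring.
Qed.

(** Here [L ^+ 2 - bochner_term F] is the trace of the squared Jacobian of [F] plus the Hessian form
    of [U] at [F], to which [bochner_lower_bound] applies. *)
Let bochner_ge x :
  2^-1 * N x <= L x ^+ 2 - bochner_term F x + (4 * MD ^+ 2 + K) * E x.
Proof.
have -> : L x ^+ 2 - bochner_term F x =
  \sum_(i < d) \sum_(j < d) partial i (F j) x * partial j (F i) x
  + \sum_(i < d) \sum_(j < d) F i x * F j x * partial i (partial j U) x.
  by rewrite /bochner_term /L; ring.
under eq_bigr do under eq_bigr do rewrite !partialF.
rewrite NE /E enorm_sqr.
under [X in _ * (_ * X)]eq_bigr do rewrite mxE.
apply: (@bochner_lower_bound _ _ (fun i j => partial i (partial j g) x)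
  (fun i j => partial i (partial j U) x) (fun i => partial i s x)
  (fun i => partial i g x)).
- by move=> i j; exact: partialC (CkW g3).
- have -> : \sum_(i < d) partial i s x ^+ 2 = enorm (grad s x) ^+ 2.
    by rewrite enorm_sqr; apply: eq_bigr => i _; rewrite mxE.
  by rewrite ler_sqr ?nnegrE ?sqrtr_ge0// (le_trans _ (sMD x)) ?sqrtr_ge0.
(* The lower bound on the Hessian of [U] is tested on the vector [grad g x]. *)
- have := UK x (grad g x).
  rewrite scaleNr opprK mulmxDr mulmxDl -!scalemxAr -!scalemxAl mulmx1.
  rewrite !mxE; congr (0 <= _ * _ + _ * _).
    under eq_bigr do rewrite !mxE mulr_suml.
    apply: eq_bigr => i _; apply: eq_bigr => j _; rewrite !mxE; ring.
  by apply: eq_bigr => i _; rewrite !mxE expr2.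
Qed.

Lemma weighted_hessian_le c : m * I (fun x => (g x - c) ^+ 2) <= I E ->
  I N <= 2 * (1 + (4 * MD ^+ 2 + K) / m) * I (fun x => L x ^+ 2).
Proof.
move=> /energy_le energy.
have bcQ := bounded_continuous_bochner Fs F2.
have bcL2 : bounded_continuous (fun x => L x ^+ 2).
  under eq_fun do rewrite expr2.
  exact: bounded_continuousM.
have bcc k :
    forall f, bounded_continuous f -> bounded_continuous (fun x => k * f x).
  by move=> f; apply: bounded_continuousM; exact: bounded_continuous_cst.
(* The sign is written as the scalar [-1] so that [integral_gibbsZ] covers the Bochner term, whose
   integral then vanishes. *)
have : I (fun x => 2^-1 * N x) <=
    I (fun x => L x ^+ 2 + (-1 * bochner_term F x + (4 * MD ^+ 2 + K) * E x)).
  apply: le_integral_gibbs; first exact: bcc.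
    apply: bounded_continuousD; first exact: bcL2.
    by apply: bounded_continuousD; exact: bcc.
  by move=> x; have := bochner_ge x; rewrite mulN1r addrA.
rewrite integral_gibbsZ// integral_gibbsD; [|exact: bcL2|]; last first.
  by apply: bounded_continuousD; exact: bcc.
rewrite integral_gibbsD; [|exact: bcc..].
rewrite !integral_gibbsZ// integral_bochner// mulr0 add0r => H.
have C0 : 0 <= 4 * MD ^+ 2 + K by rewrite addr_ge0// mulr_ge0// sqr_ge0.
exact: combine_bounds C0 energy H.
Qed.

Lemma gibbs_weighted_hessian_le c :
  (m%:E * gibbs_sqnorm2 U (fun x => g x - c)%R <= \int[gibbs U]_x (E x)%:E)%E ->
  (\int[gibbs U]_x (N x)%:E <= (2 * (1 + (4 * MD ^+ 2 + K) / m))%:E *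
     gibbs_sqnorm2 U (generator U s g))%E.
Proof.
rewrite generatorE !gibbs_sqnorm2E//; last first.
  by apply: bounded_continuousD => //; exact: bounded_continuous_cst.
(* [gibbs U] is convertible to the bundled [mu], so the extended-real integrals become finite values
   of [I]. *)
rewrite -[gibbs U]/(mu : set _ -> _) !EFin_integral_gibbs// -!EFinM !lee_fin.
exact: weighted_hessian_le.
Qed.

End weighted_hessian.
End bochner.

(** * Test functions and comparison of constants *)

Lemma Cc3_Cb1 (R : realType) (d : nat) (g : 'rV[R]_d -> R) : Cc3 g -> Cb1 g.
Proof.
move=> [g3 /compact_csupp gs]; have g1 : Ck 1 g := CkW (CkW g3).
split=> //; first exact: bounded_csupp (Ck_continuous g1) gs.
pose e x := \sum_(i < d) partial i g x ^+ 2.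
have ec : continuous e.
  apply: (@Ck_continuous _ _ 0); apply: Ck_sum => i.
  exact: (@CkX _ _ 0 2 (partial i g)) (Ck_partial i g1).
have es : csupp e.
  apply: csupp_sum => i; apply: csuppW (csupp_partial i gs) _ => x ->.
  by rewrite expr0n.
have [M eM] := bounded_csupp ec es.
exists (1 + M) => x.
have : enorm (grad g x) ^+ 2 <= M.
  rewrite enorm_sqr; apply: le_trans (eM x); apply: le_trans (ler_norm _).
  by apply: ler_sum => i _; rewrite mxE.
(* From [2 * t <= 1 + t ^+ 2] and [t ^+ 2 <= M], the norm is at most [1 + M]. *)
by move: (enorm _) => t tM; have := sqr_ge0 (t - 1); nra.
Qed.

Theorem lemma4p2 (R : realType) (d : nat) (U s : 'rV[R]_d -> R)
    (m MD MH MUs K : R) :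
  (1 <= d)%N ->
  smooth U ->
  (0 < partition_function U < +oo)%E ->
  smooth s -> lipschitz_enorm s -> (forall x, 1 <= s x) ->
  0 < m -> 0 <= MD -> 0 <= MH -> 0 <= MUs -> 0 <= K ->
  (forall g, Cb1 g ->
    (m%:E * gibbs_sqnorm2 U (fun x => (g x - gibbs_mean U g)%R)
     <= \int[gibbs U]_x (s x ^+ 2 * enorm (grad g x) ^+ 2)%:E)%E) ->
  (forall x, enorm (grad s x) <= MD) ->
  (forall x, s x * frobenius (hess s x) <= MH) ->
  (forall x, s x * enorm (grad U x) <= MUs) ->
  (exists C, forall x, s x ^+ 2 * frobenius (hess U x) <= C) ->
  (forall x, psd (s x ^+ 2 *: hess U x - (- K) *: 1%:M)) ->
  let K1 := 3 * MUs * MD + (2 + Num.sqrt d%:R) * MH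
            + (2 + 2 * (Num.sqrt d%:R + 2) ^+ 2) * MD ^+ 2 + K in
  forall g, Cc3 g ->
    (\int[gibbs U]_x (s x ^+ 4 * frobenius (hess g x) ^+ 2)%:E
     <= (2 * (1 + K1 / m))%:E * gibbs_sqnorm2 U (generator U s g))%E.
Proof.
move=> _ sU Z_fin ss _ _ m0 MD0 MH0 MUs0 K0 poincare sMD _ _ _ UK K1 g gc.
have [g3 /compact_csupp gs] := gc.
(* The estimate is taken with [c] the Gibbs mean of [g] and constant [4 * MD ^+ 2 + K]; it remains
   to compare this constant with [K1]. *)
apply: le_trans (gibbs_weighted_hessian_le (sU 2%N) Z_fin (ss 2%N) g3 gs m0 K0
  sMD UK (poincare g (Cc3_Cb1 gc))) _.
have norm_ge0 : (0 <= gibbs_sqnorm2 U (generator U s g))%E.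
  apply: integral_ge0 => [|x _]; last by rewrite lee_fin sqr_ge0.
  exact: continuous_measurable_rV (sU 0%N).
apply: lee_wpmul2r => //.
rewrite lee_fin ler_pM2l// lerD2l ler_pM2r ?invr_gt0// /K1 {K1}.
have := sqrtr_ge0 (d%:R : R); move: (Num.sqrt d%:R) => q q0.
have A1 : 0 <= MUs * MD by exact: mulr_ge0.
have A2 : 0 <= (2 + q) * MH by rewrite mulr_ge0// addr_ge0.
(* As [q >= 0], the coefficient on the right is at least [2 + 2 * 2 ^+ 2 = 10]. *)
have A3 : 4 * MD ^+ 2 <= (2 + 2 * (q + 2) ^+ 2) * MD ^+ 2.
  by rewrite ler_wpM2r ?sqr_ge0//; nra.
lra.
Qed.
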